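(* Let $\mathfrak{g}$ be the $7$-dimensional Lie algebra with basis $\{e_1,\dots,e_7\}$ whose Lie bracket is determined by $A_1\in\mathfrak{gl}_2(\mathbb{R})$ and $A,B,C\in\mathfrak{gl}_4(\mathbb{R})$ as described in the context, and let $\varphi=e^{127}+e^{347}+e^{567}+e^{135}-e^{146}-e^{236}-e^{245}$. Then: (i) $\ast\varphi=e^{3456}+\omega_7\wedge e^{12}+\omega_1\wedge e^{27}-\omega_2\wedge e^{17}$; (ii) $d\ast\varphi=-\operatorname{tr}(A)\,e^{34567}+\left(\theta(A)\omega_7-\operatorname{tr}(A_1)\,\omega_7+\theta(B)\omega_1+\theta(C)\omega_2\right)\wedge e^{127}$; (iii) $\ast d\ast\varphi=-\operatorname{tr}(A)\,e^{12}+\ast_{\mathfrak{g}_1}\left(\theta(A)\omega_7-\operatorname{tr}(A_1)\,\omega_7+\theta(B)\omega_1+\theta(C)\omega_2\right)$; (iv) $d\ast d\ast\varphi=\operatorname{tr}(A_1)\operatorname{tr}(A)\,e^{127}-\theta(A)\beta\wedge e^7-\theta(B)\beta\wedge e^1-\theta(C)\beta\wedge e^2$, where $\beta:=(\operatorname{tr}(A_1)+\operatorname{tr}(A))\,\omega_7+\theta(A^t)\omega_7+\theta(B^t)\omega_1+\theta(C^t)\omega_2$.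
   Context: $\mathfrak{g}$ is a $7$-dimensional Lie algebra with basis $\{e_1,\dots,e_7\}$, dual basis $\{e^1,\dots,e^7\}$, $e^{ij\dots}=e^i\wedge e^j\wedge\cdots$. The bracket is given by $A_1=\operatorname{ad}e_7|_{\operatorname{span}\{e_1,e_2\}}=\begin{pmatrix}x&z\\ y&w\end{pmatrix}$, $A=\operatorname{ad}e_7|_{\mathfrak{g}_1}$, $B=\operatorname{ad}e_1|_{\mathfrak{g}_1}$, $C=\operatorname{ad}e_2|_{\mathfrak{g}_1}$, where $\mathfrak{g}_1=\operatorname{span}\{e_3,e_4,e_5,e_6\}$ is an abelian ideal, $\operatorname{span}\{e_1,e_2\}$ is abelian, $\operatorname{span}\{e_7,e_1,e_2\}$ is a subalgebra, $\operatorname{tr}B=\operatorname{tr}C=0$, and $[A,B]=xB+yC$, $[A,C]=zB+wC$, $[B,C]=0$. The positive $3$-form $\varphi$ makes $\{e_1,\dots,e_7\}$ an oriented orthonormal basis; $\ast$ is its Hodge star and $\ast_{\mathfrak{g}_1}$ the Hodge star of $\Lambda^\bullet\mathfrak{g}_1^*$ (orientation $e^{3456}$). $\omega_7=e^{34}+e^{56}$, $\omega_1=e^{35}-e^{46}$, $\omega_2=-e^{36}-e^{45}$. For $M\in\mathfrak{gl}(\mathfrak{g}_1)$, $\theta(M)$ acts on $\Lambda^k\mathfrak{g}_1^*$ by $\theta(M)\alpha(v_1,\dots,v_k)=-\alpha(Mv_1,\dots,v_k)-\dots-\alpha(v_1,\dots,Mv_k)$. *)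

(* Defs.v *)
From mathcomp Require Import all_boot all_order all_algebra.
Set Implicit Arguments. Unset Strict Implicit. Unset Printing Implicit Defensive.
Import Order.TTheory GRing.Theory Num.Theory.
Local Open Scope ring_scope.

Section Forms.
Variable R : comRingType.

(* A (possibly inhomogeneous) exterior form on g = R^7 is represented by its
   values on tuples of basis vectors: alpha [:: i1; ..; ik] = alpha(e_i1,..,e_ik)
   for the degree-k component.  Basis index i : 'I_7 stands for e_(i+1). *)
Definition form := seq 'I_7 -> R.

Definition fadd (f g : form) : form := fun s => f s + g s.
Definition fsub (f g : form) : form := fun s => f s - g s.
Definition fscale (a : R) (f : form) : form := fun s => a * f s.

Definition eb (I : seq 'I_7) : form := fun s =>
  if size s == size I then
    \det (\matrix_(a < size I, b < size I) ((nth ord0 s a == nth ord0 I b)%:R : R))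
  else 0.

(* e^{i1...ik} with the paper's 1-based labels, e.g. ee [:: 1; 2; 7]%N = e^{127} *)
Definition ee (l : seq nat) : form := eb [seq (inord i.-1 : 'I_7) | i <- l].

Definition subt (s : seq 'I_7) (S : {set 'I_(size s)}) : seq 'I_7 :=
  [seq nth ord0 s (val i) | i <- enum S].

Definition shuf m (S : {set 'I_m}) : nat :=
  #|[set p : 'I_m * 'I_m | (p.1 \in S) && (p.2 \notin S) && (p.2 < p.1)%N]|.

(* wedge product: (a /\ b)(v_1..v_{p+q}) = sum over (p,q)-shuffles *)
Definition wedge (f g : form) : form := fun s =>
  \sum_(S : {set 'I_(size s)}) (-1) ^+ shuf S * f (subt S) * g (subt (~: S)).

(* Hodge star of the metric making e_1..e_7 oriented orthonormal
   (volume form e^{1234567}) *)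
Definition vol : form := eb (enum 'I_7).
Definition hodge (f : form) : form := fun s =>
  \sum_(S : {set 'I_7} | (#|S| + size s == 7)%N) f (enum S) * vol (enum S ++ s).

(* g1 = span {e3,e4,e5,e6} = indices 2..5 *)
Definition in_g1 (k : 'I_7) : bool := (2 <= k <= 5)%N.
Definition g1set : {set 'I_7} := [set k | in_g1 k].
Definition g1i (k : 'I_7) : 'I_4 := inord (k - 2).
Definition i2 (k : 'I_7) : 'I_2 := inord k.

(* Hodge star of Lambda g1^* (orientation e^{3456}), where Lambda g1^* is
   identified with the forms on g only involving e^3..e^6 *)
Definition vol_g1 : form := ee [:: 3; 4; 5; 6]%N.
Definition hodge_g1 (f : form) : form := fun s =>
  \sum_(S : {set 'I_7} | (S \subset g1set) && (#|S| + size s == 4)%N)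
     f (enum S) * vol_g1 (enum S ++ s).

(* theta(M) for M in gl(g1), M acting on g1 in the basis e3..e6
   (M e_j = sum_i M i j e_i):
   theta(M) a (v1..vk) = - sum_i a(v1,..,M v_i,..,vk) *)
Definition extg1 (M : 'M[R]_4) (k j : 'I_7) : R :=
  if in_g1 k && in_g1 j then M (g1i k) (g1i j) else 0.
Definition theta (M : 'M[R]_4) (f : form) : form := fun s =>
  - \sum_(i < size s) \sum_(k : 'I_7) extg1 M k (nth ord0 s i) * f (set_nth ord0 s i k).

(* The Lie bracket: ad e7 = A1 on span{e1,e2}, = A on g1; ad e1 = B on g1,
   ad e2 = C on g1; all other brackets of basis vectors not determined by
   antisymmetry vanish.  adp i j k = e^k([e_i, e_j]) contribution from the
   "active" element e_i in {e1,e2,e7}. *)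
Definition adp (A1 : 'M[R]_2) (A B C : 'M[R]_4) (i j k : 'I_7) : R :=
  if i == 6 :> nat then
    (if (j < 2)%N && (k < 2)%N then A1 (i2 k) (i2 j)
     else if in_g1 j && in_g1 k then A (g1i k) (g1i j) else 0)
  else if i == 0 :> nat then
    (if in_g1 j && in_g1 k then B (g1i k) (g1i j) else 0)
  else if i == 1 :> nat then
    (if in_g1 j && in_g1 k then C (g1i k) (g1i j) else 0)
  else 0.

(* structure constants: sc k i j = e^k([e_i, e_j]) *)
Definition sc A1 A B C (k i j : 'I_7) : R := adp A1 A B C i j k - adp A1 A B C j i k.

Definition rm2 (s : seq 'I_7) (i j : nat) : seq 'I_7 :=
  [seq nth ord0 s l | l <- iota 0 (size s) & (l != i) && (l != j)].

(* Chevalley-Eilenberg differential for structure constants c: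
   d a (v0..vk) = sum_{i<j} (-1)^(i+j) a([v_i,v_j], v0,..^i..^j..,vk) *)
Definition dform (c : 'I_7 -> 'I_7 -> 'I_7 -> R) (f : form) : form := fun s =>
  \sum_(i < size s) \sum_(j < size s | (i < j)%N)
     (-1) ^+ (i + j) * \sum_(k : 'I_7) c k (nth ord0 s i) (nth ord0 s j) * f (k :: rm2 s i j).

End Forms.

Declare Scope form_scope.
Delimit Scope form_scope with F.
Notation "f \+ g" := (fadd f g) : form_scope.
Notation "f \- g" := (fsub f g) : form_scope.
Notation "a \*: f" := (fscale a f) : form_scope.
Notation "f \wedge g" := (wedge f g) (at level 40, left associativity) : form_scope.

Definition phi0 {R : comRingType} : form R :=
  (ee R [:: 1; 2; 7]%N \+ ee R [:: 3; 4; 7]%N \+ ee R [:: 5; 6; 7]%N \+ ee R [:: 1; 3; 5]%N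
   \- ee R [:: 1; 4; 6]%N \- ee R [:: 2; 3; 6]%N \- ee R [:: 2; 4; 5]%N)%F.
Definition omega7 {R : comRingType} : form R := (ee R [:: 3; 4]%N \+ ee R [:: 5; 6]%N)%F.
Definition omega1 {R : comRingType} : form R := (ee R [:: 3; 5]%N \- ee R [:: 4; 6]%N)%F.
Definition omega2 {R : comRingType} : form R := ((-1) \*: ee R [:: 3; 6]%N \- ee R [:: 4; 5]%N)%F.

(* Main.v *)
(** Let [eps a] be exterior multiplication by [e^a] and [act m] the degree-0
    derivation extending the transpose of [m].  Writing each bracket as
    [[e_i, e_j] = p_i e_j - p_j e_i], where [p_i] is nonzero only for the active
    elements [e_1, e_2, e_7], the differential becomes
    [d = - sum_a eps a o act (p_a)], since both sides are odd derivations with the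
    same values on 1-forms.  As wedging an even form with [e^J] on the right is
    applying the [eps a], [a] in [J], all four formulas become computations with
    the relations [eps a o eps b = - eps b o eps a] and
    [act m o eps a = eps a o act m + sum_j m_aj eps j].  The last one rests on
    [hodge_g1 gam = - beta], which holds because the [omega_i] are self-dual. *)

Require Import Defs.
From mathcomp Require Import all_boot all_order all_algebra.
From mathcomp Require Import ring.
From Stdlib Require Import FunctionalExtensionality.
Set Implicit Arguments. Unset Strict Implicit. Unset Printing Implicit Defensive.
Import GRing.Theory.
Local Open Scope ring_scope.

Local Notation form := Defs.form.

(** * Exterior multiplication and derivations on forms given by their values on tuples *)

Section Operators.
Variable R : comNzRingType.
Implicit Types (f g : form R) (m : 'I_7 -> 'I_7 -> R) (s : seq 'I_7).

Definition cont (x : 'I_7) f : form R := fun s => f (x :: s).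

(** The recursion is the contraction rule i_x(e^a ∧ f) = e^a(e_x) f - e^a ∧ i_x f, with [cont x] as
    i_x. *)
Fixpoint eps (a : 'I_7) f s : R :=
  if s is x :: s' then (x == a)%:R * f s' - eps a (cont x f) s' else 0.

(** Applies the endomorphism e_x -> sum_k m_kx e_k to each argument in turn and adds up; the sign is
    opposite to that of [theta]. *)
Fixpoint act m f s : R :=
  if s is x :: s' then \sum_k m k x * f (k :: s') + act m (cont x f) s' else 0.

(** The grading involution: it carries the sign of moving a 1-form past [f], also for inhomogeneous
    [f]. *)
Definition alt f : form R := fun s => (-1) ^+ size s * f s.

(** Elements of [form] are arbitrary functions of tuples, so alternation is a separate property;
    swaps of neighbours are what commuting two contractions requires. *)
Definition antisym f := forall p x y s, f (p ++ x :: y :: s) = - f (p ++ y :: x :: s).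

Lemma eps_eq0 a f s : (forall t, f t = 0) -> eps a f s = 0.
Proof.
elim: s f => //= x s IH f f0; rewrite f0 mulr0 IH ?subr0 // => t.
exact: f0.
Qed.

Lemma eps_lin2 a (u v : R) f g s :
  eps a (fun t => u * f t + v * g t) s = u * eps a f s + v * eps a g s.
Proof.
elim: s f g => [|x s IH] f g /=; first by rewrite !mulr0 addr0.
rewrite [eps a (cont x _) s]IH; ring.
Qed.

Lemma act_lin2 m (u v : R) f g s :
  act m (fun t => u * f t + v * g t) s = u * act m f s + v * act m g s.
Proof.
elim: s f g => [|x s IH] f g /=; first by rewrite !mulr0 addr0.
rewrite [act m (cont x _) s]IH !mulrDr addrACA; congr (_ + _).
rewrite !mulr_sumr -big_split /=; apply: eq_bigr => k _; ring.
Qed.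

Lemma eps_scale a u f : eps a (u \*: f)%F = (u \*: eps a f)%F.
Proof.
apply: functional_extensionality => s; rewrite /fscale -[RHS]addr0 -(mul0r (eps a f s)).
rewrite -eps_lin2; congr (eps _ _ _); apply: functional_extensionality => t; ring.
Qed.

Lemma eps_add a f g : eps a (f \+ g)%F = (eps a f \+ eps a g)%F.
Proof.
apply: functional_extensionality => s; rewrite /fadd -[X in X + _]mul1r -[X in _ + X]mul1r.
rewrite -eps_lin2; congr (eps _ _ _); apply: functional_extensionality => t; ring.
Qed.

Lemma eps_sub a f g : eps a (f \- g)%F = (eps a f \- eps a g)%F.
Proof.
apply: functional_extensionality => s; rewrite /fsub -[X in X - _]mul1r -mulN1r.
rewrite -eps_lin2; congr (eps _ _ _); apply: functional_extensionality => t; ring.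
Qed.

Lemma act_scale m u f : act m (u \*: f)%F = (u \*: act m f)%F.
Proof.
apply: functional_extensionality => s; rewrite /fscale -[RHS]addr0 -(mul0r (act m f s)).
rewrite -act_lin2; congr (act _ _ _); apply: functional_extensionality => t; ring.
Qed.

Lemma act_add m f g : act m (f \+ g)%F = (act m f \+ act m g)%F.
Proof.
apply: functional_extensionality => s; rewrite /fadd -[X in X + _]mul1r -[X in _ + X]mul1r.
rewrite -act_lin2; congr (act _ _ _); apply: functional_extensionality => t; ring.
Qed.

Lemma act_sub m f g : act m (f \- g)%F = (act m f \- act m g)%F.
Proof.
apply: functional_extensionality => s; rewrite /fsub -[X in X - _]mul1r -mulN1r.
rewrite -act_lin2; congr (act _ _ _); apply: functional_extensionality => t; ring.
Qed.

Lemma actD_mat m1 m2 f :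
  act (fun k j => m1 k j + m2 k j) f = (act m1 f \+ act m2 f)%F.
Proof.
apply: functional_extensionality => s; rewrite /fadd.
elim: s f => [|x s IH] f /=; first by rewrite addr0.
rewrite IH addrACA; congr (_ + _).
by rewrite -big_split /=; apply: eq_bigr => k _; rewrite mulrDl.
Qed.

Lemma eps_sum a (u : 'I_7 -> R) (F : 'I_7 -> form R) s :
  eps a (fun t => \sum_k u k * F k t) s = \sum_k u k * eps a (F k) s.
Proof.
elim: s F => [|x s IH] F /=; first by rewrite big1 // => k _; rewrite mulr0.
rewrite [eps a (cont x _) s](IH (fun k => cont x (F k))) mulr_sumr -sumrB.
by apply: eq_bigr => k _; rewrite -/(cont x (F k)); ring.
Qed.

Lemma cont_eps a x f : cont x (eps a f) = ((x == a)%:R \*: f \- eps a (cont x f))%F.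
Proof. by []. Qed.

(** After contraction with e_x the two Kronecker terms change sign under exchange of [a] and [b];
    the remaining term is the induction hypothesis. *)
Lemma eps_anticomm a b f : eps a (eps b f) = (-1 \*: eps b (eps a f))%F.
Proof.
apply: functional_extensionality => s; rewrite /fscale.
elim: s f => [|x s IH] f /=; first by rewrite mulr0.
rewrite !cont_eps !eps_sub !eps_scale /fsub /fscale IH; ring.
Qed.

(** The Leibniz rule: the sum over [j] is the derivation applied to the 1-form e^a. *)
Lemma act_eps m a f :
  act m (eps a f) = (fun s => \sum_j m a j * eps j f s + eps a (act m f) s).
Proof.
apply: functional_extensionality => s.
elim: s f => [|x s IH] f /=.
  by rewrite addr0 big1 // => j _; rewrite mulr0.
rewrite cont_eps act_sub act_scale /fsub /fscale IH.
have -> : cont x (act m f) =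
    ((fun t => \sum_k m k x * cont k f t) \+ act m (cont x f))%F by [].
rewrite eps_add /fadd eps_sum.
under eq_bigr do rewrite mulrBr.
under [in RHS]eq_bigr do rewrite mulrBr.
rewrite !sumrB.
have -> : \sum_k m k x * ((k == a)%:R * f s) = m a x * f s.
  by rewrite (bigD1 a) //= eqxx mul1r big1 ?addr0 // => k /negPf->; rewrite mul0r mulr0.
have -> : \sum_k m a k * ((x == k)%:R * f s) = m a x * f s.
  rewrite (bigD1 x) //= eqxx mul1r big1 ?addr0 // => k.
  by rewrite eq_sym => /negPf->; rewrite mul0r mulr0.
ring.
Qed.

Lemma sum_eps_cons (g : 'I_7 -> form R) x s :
  \sum_a eps a (g a) (x :: s) = g x s - \sum_a eps a (cont x (g a)) s.
Proof.
rewrite /= sumrB; congr (_ - _); rewrite (bigD1 x) //= eqxx mul1r big1 ?addr0 // => k.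
by rewrite eq_sym => /negPf->; rewrite mul0r.
Qed.

(** * Alternating forms *)

Lemma antisym_cont x f : antisym f -> antisym (cont x f).
Proof. by move=> h p; apply: (h (x :: p)). Qed.

Lemma antisym_scale u f : antisym f -> antisym (u \*: f)%F.
Proof. by move=> h p x y s; rewrite /fscale h mulrN. Qed.

Lemma antisym_add f g : antisym f -> antisym g -> antisym (f \+ g)%F.
Proof. by move=> hf hg p x y s; rewrite /fadd hf hg opprD. Qed.

Lemma antisym_sub f g : antisym f -> antisym g -> antisym (f \- g)%F.
Proof. by move=> hf hg p x y s; rewrite /fsub hf hg opprD. Qed.

Lemma cont2_skew x y f : antisym f -> cont x (cont y f) = (-1 \*: cont y (cont x f))%F.
Proof.
by move=> h; apply: functional_extensionality => s; rewrite /fscale mulN1r; apply: (h [::]).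
Qed.

Lemma antisym_eps a f : antisym f -> antisym (eps a f).
Proof.
move=> sf p; elim: p f sf => [|z p IH] f sf x y s /=.
  rewrite (cont2_skew x y sf) eps_scale /fscale /cont; ring.
by rewrite (IH _ (antisym_cont z sf)) sf; ring.
Qed.

(** The identity act m = sum_a e^a ∧ i_{m e_a}. Under contraction with e_x both sides produce i_{m
    e_x} f, and the rest agrees because contractions of an alternating form anticommute. *)
Lemma act_sum_eps m f s : antisym f ->
  act m f s = \sum_a eps a (fun t => \sum_k m k a * f (k :: t)) s.
Proof.
elim: s f => [|x s IH] f sf; first by rewrite big1.
rewrite sum_eps_cons /= IH; last exact: antisym_cont.
congr (_ + _); rewrite -sumrN; apply: eq_bigr => a _.
rewrite /cont (eps_sum _ _ (fun k => cont k (cont x f))).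
rewrite (eps_sum _ _ (fun k => cont x (cont k f))) -sumrN; apply: eq_bigr => k _.
rewrite (cont2_skew k x sf) eps_scale /fscale; ring.
Qed.

(** * The Chevalley-Eilenberg differential through exterior multiplication *)

Definition rm1 s j := take j s ++ drop j.+1 s.

Lemma size_rm1 s j : (j < size s)%N -> size (rm1 s j) = (size s).-1.
Proof.
move=> js; rewrite /rm1 size_cat size_takel; last exact: ltnW.
by rewrite size_drop -{2}(subnKC js).
Qed.

(** Unrolling the recursion gives the usual alternating sum over the omitted argument. *)
Lemma sum_eps_nth (g : 'I_7 -> form R) s :
  \sum_a eps a (g a) s = \sum_(j < size s) (-1) ^+ j * g (nth ord0 s j) (rm1 s j).
Proof.
elim: s g => [|x s IH] g; first by rewrite big_ord0 big1.
rewrite sum_eps_cons IH big_ord_recl /= expr0 mul1r /rm1 /= drop0; congr (_ + _).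
rewrite -sumrN; apply: eq_bigr => j _.
by rewrite exprS /cont mulN1r mulNr.
Qed.

Lemma rm2_cons x s i j : rm2 (x :: s) i.+1 j.+1 = x :: rm2 s i j.
Proof.
rewrite /rm2 /=; congr cons; rewrite (iotaDl 1 0) filter_map -map_comp.
by congr map; apply: eq_filter.
Qed.

Lemma rm2_0 x s j : (j < size s)%N -> rm2 (x :: s) 0 j.+1 = rm1 s j.
Proof.
rewrite /rm2 /rm1 /= (iotaDl 1 0) filter_map -map_comp => js.
rewrite -{1}(cat_take_drop j s) (drop_nth ord0 js).
(* The positions split into those below [j], [j] itself, and those above; the filter discards
   exactly the middle one. *)
have -> : size s = (j + (size s - j.+1).+1)%N by rewrite addnS -addSn subnKC.
rewrite iotaD add0n filter_cat /= eqxx /=.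
rewrite (eq_in_filter (a2 := predT)); last first.
  by move=> l; rewrite mem_iota /= add0n eqSS => /ltn_eqF ->.
rewrite (eq_in_filter (s := iota _ _) (a2 := predT)); last first.
  by move=> l; rewrite mem_iota /= eqSS => /andP[/gtn_eqF-> _].
rewrite !filter_predT map_cat; congr cat.
  apply: (@eq_from_nth _ ord0); first by rewrite size_map size_iota size_takel // ltnW.
  move=> l; rewrite size_map size_iota => lj.
  rewrite (nth_map 0%N) ?size_iota // nth_iota //= add0n.
  by rewrite nth_cat size_takel ?lj // ltnW.
apply: (@eq_from_nth _ ord0); first by rewrite size_map size_iota size_drop.
move=> l; rewrite size_map size_iota => lj.
rewrite (nth_map 0%N) ?size_iota // nth_iota //= nth_cat size_takel; last exact: ltnW.
rewrite ltnNge (leq_trans (leqnSn j) (leq_addr _ _)) /=.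
by rewrite addSn subSn ?leq_addr //= addKn.
Qed.

(** The differential with the contraction by [e_a, e_b] replaced by an arbitrary family [h a b],
    which makes a recursion on the argument list possible. *)
Definition dgen (h : 'I_7 -> 'I_7 -> form R) : form R := fun s =>
  \sum_(i < size s) \sum_(j < size s | (i < j)%N)
     (-1) ^+ (i + j) * h (nth ord0 s i) (nth ord0 s j) (rm2 s i j).

(** Pairs of positions avoiding the first shift by one each, so their sign is unchanged; pairs
    containing it have sign (-1)^(j+1) and form the subtracted sum. *)
Lemma dgen_cons h x s :
  dgen h (x :: s) = dgen (fun a b => cont x (h a b)) s - \sum_a eps a (h x a) s.
Proof.
rewrite /dgen big_ord_recl big_mkcond /= big_ord_recl /= add0r addrC; congr (_ + _).
  apply: eq_bigr => i _; rewrite big_mkcond big_ord_recl /= add0r [RHS]big_mkcond.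
  apply: eq_bigr => j _; rewrite /= /bump !add1n ltnS; case: ifP => // _.
  by rewrite rm2_cons addnS addSn 2!exprS mulN1r mulN1r opprK.
rewrite sum_eps_nth -sumrN; apply: eq_bigr => j _.
by rewrite /bump !add1n /= add0n exprS rm2_0 //= mulN1r mulNr.
Qed.

(** Both sides obey the same Cartan-type recursion under contraction with e_x: the half p_x of the
    bracket [e_x, e_a] assembles into [act] by [act_sum_eps], and the half p_a is the effect of
    [act] on the argument e_x. *)
Lemma dform_sum_eps (p : 'I_7 -> 'I_7 -> 'I_7 -> R) f s : antisym f ->
  dform (fun k i j => p i j k - p j i k) f s =
  - \sum_a eps a (act (fun k j => p a j k) f) s.
Proof.
pose h f a b : form R := fun t => \sum_k (p a b k - p b a k) * f (k :: t).
have -> : dform (fun k i j => p i j k - p j i k) f s = dgen (h f) s by [].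
elim: s f => [|x s IH] f sf.
  by rewrite /dgen big_ord0 big1 ?oppr0.
rewrite dgen_cons sum_eps_cons.
(* The sign comes from moving the bracket, inserted in front, past e_x. *)
have -> : (fun a b => cont x (h f a b)) =
          (fun a b => (-1 \*: h (cont x f) a b)%F).
  do 3![apply: functional_extensionality => ?].
  rewrite /cont /h /fscale mulN1r -sumrN; apply: eq_bigr => k _.
  by rewrite (sf [::]) mulrN.
have -> : dgen (fun a b => (-1 \*: h (cont x f) a b)%F) s = - dgen (h (cont x f)) s.
  rewrite /dgen -sumrN; apply: eq_bigr => i _; rewrite -sumrN; apply: eq_bigr => j _.
  by rewrite /fscale; ring.
rewrite (IH _ (antisym_cont x sf)) (act_sum_eps _ _ sf).
have -> : \sum_a eps a (cont x (act (fun k j => p a j k) f)) s =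
    \sum_a eps a (fun t => \sum_k p a x k * f (k :: t)) s +
    \sum_a eps a (act (fun k j => p a j k) (cont x f)) s.
  rewrite -big_split /=; apply: eq_bigr => a _.
  have -> : cont x (act (fun k j => p a j k) f) =
     ((fun t => \sum_k p a x k * f (k :: t)) \+ act (fun k j => p a j k) (cont x f))%F by [].
  by rewrite eps_add.
have -> : \sum_a eps a (h f x a) s =
    \sum_a eps a (fun t => \sum_k p x a k * f (k :: t)) s -
    \sum_a eps a (fun t => \sum_k p a x k * f (k :: t)) s.
  rewrite -sumrB; apply: eq_bigr => a _.
  have -> : h f x a = ((fun t => \sum_k p x a k * f (k :: t)) \-
                       (fun t => \sum_k p a x k * f (k :: t)))%F.
    apply: functional_extensionality => t; rewrite /h /fsub -sumrB.
    by apply: eq_bigr => k _; rewrite mulrBl.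
  by rewrite eps_sub.
ring.
Qed.

(** * Recursion for the wedge product and for basis forms *)

Lemma alt_cont x f : cont x (alt f) = (-1 \*: alt (cont x f))%F.
Proof.
apply: functional_extensionality => s.
by rewrite /cont /alt /fscale /= exprS mulrA.
Qed.

Lemma altK f : alt (alt f) = f.
Proof.
apply: functional_extensionality => s.
by rewrite /alt mulrA -expr2 sqrr_sign mul1r.
Qed.

(** Prepends a position to a shuffle: [b] tells whether the first argument goes to the left
    factor. *)
Definition cons_set n (b : bool) (S : {set 'I_n}) : {set 'I_n.+1} :=
  [set i | if unlift ord0 i is Some j then j \in S else b].

Lemma in_cons_set0 n b (S : {set 'I_n}) : (ord0 \in cons_set b S) = b.
Proof. by rewrite inE unlift_none. Qed.

Lemma in_cons_setS n b (S : {set 'I_n}) j : (lift ord0 j \in cons_set b S) = (j \in S).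
Proof. by rewrite inE liftK. Qed.

Lemma enum_cons_set n b (S : {set 'I_n}) :
  enum (cons_set b S) = (if b then [:: ord0] else [::]) ++ map (lift ord0) (enum S).
Proof.
have enum_filter k (U : {set 'I_k}) : enum U = [seq i <- enum 'I_k | i \in U].
  by rewrite [enum 'I_k]enumT.
rewrite !enum_filter enum_ordSl /= in_cons_set0 filter_map (eq_filter (a2 := mem S)).
  by case: b.
by move=> j /=; rewrite in_cons_setS.
Qed.

Lemma setC_cons_set n b (S : {set 'I_n}) : ~: cons_set b S = cons_set (~~ b) (~: S).
Proof. by apply/setP => i; rewrite !inE; case: unliftP => [j|] _; rewrite ?inE. Qed.

Lemma big_cons_set n (F : {set 'I_n.+1} -> R) :
  \sum_S F S = \sum_(S : {set 'I_n}) F (cons_set true S) +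
               \sum_(S : {set 'I_n}) F (cons_set false S).
Proof.
pose dec (S : {set 'I_n.+1}) := (ord0 \in S, [set j | lift ord0 j \in S]).
pose enc (q : bool * {set 'I_n}) := cons_set q.1 q.2.
have encK : cancel enc dec.
  case=> b S; rewrite /dec /enc in_cons_set0; congr pair.
  by apply/setP => j; rewrite inE in_cons_setS.
have decK : cancel dec enc.
  move=> S; apply/setP => i; rewrite /enc !inE /=.
  by case: unliftP => [j|] ->; rewrite ?inE.
rewrite (reindex enc); last by exists dec => ? _.
rewrite -(pair_bigA _ (fun b S => F (cons_set b S))) /=.
by rewrite big_bool.
Qed.

Lemma shufE n (S : {set 'I_n}) :
  shuf S = (\sum_(i < n) \sum_(j < n) ((i \in S) && (j \notin S) && (j < i)))%N.
Proof.
rewrite /shuf -sum1_card big_mkcond /=.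
rewrite (pair_bigA _ (fun i j : 'I_n => ((i \in S) && (j \notin S) && (j < i)%N) : nat)) /=.
by apply: eq_bigr => p _; rewrite inE; case: ifP.
Qed.

(** The new position is the smallest: inside the set it creates no inversion, outside it creates one
    with each element of [S]. *)
Lemma shuf_cons_set n b (S : {set 'I_n}) :
  shuf (cons_set b S) = (shuf S + if b then 0 else #|S|)%N.
Proof.
rewrite !shufE big_ord_recl big1 ?add0n; last by move=> j _; rewrite ltn0 andbF.
under eq_bigr do rewrite big_ord_recl in_cons_set0 in_cons_setS /= andbT.
rewrite big_split /= addnC; congr addn; last first.
  case: b => /=; first by rewrite big1 // => i _; rewrite andbF.
  by rewrite -sum1_card [RHS]big_mkcond /=; apply: eq_bigr => i _; rewrite andbT; case: ifP.
by apply: eq_bigr => i _; apply: eq_bigr => j _; rewrite in_cons_setS.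
Qed.

Lemma subt_cons_set x s b (S : {set 'I_(size s)}) :
  @subt (x :: s) (cons_set b S) = (if b then [:: x] else [::]) ++ subt S.
Proof.
rewrite /subt enum_cons_set map_cat -map_comp; congr cat; by case: b.
Qed.

(** Contraction is an antiderivation of the wedge product; the extra sign (-1)^|S| is absorbed by
    [alt]. *)
Lemma wedge_cons f g x s :
  wedge f g (x :: s) = wedge (cont x f) g s + wedge (alt f) (cont x g) s.
Proof.
rewrite /wedge big_cons_set; congr (_ + _); apply: eq_bigr => S _;
  rewrite shuf_cons_set setC_cons_set !subt_cons_set /= ?addn0 //.
by rewrite exprD /alt {1}/subt size_map -cardE mulrA.
Qed.

Lemma wedge_nil f g : wedge f g [::] = f [::] * g [::].
Proof.
rewrite /wedge (bigD1 set0) //= big1 ?addr0; last first.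
  by move=> S /eqP[]; apply/setP => -[].
have -> : shuf (set0 : {set 'I_0}) = 0%N by rewrite shufE big_ord0.
have subt0 (S : {set 'I_0}) : @subt [::] S = [::].
  by rewrite /subt (_ : enum S = [::]) //; case: (enum S) => // -[].
by rewrite !subt0 mul1r.
Qed.

Lemma wedge_lin2r f (u v : R) g h :
  wedge f (u \*: g \+ v \*: h)%F = (u \*: wedge f g \+ v \*: wedge f h)%F.
Proof.
apply: functional_extensionality => s.
rewrite /wedge /fadd /fscale !mulr_sumr -big_split /=; apply: eq_bigr => S _; ring.
Qed.

Lemma wedge_lin2l g (u v : R) f h :
  wedge (u \*: f \+ v \*: h)%F g = (u \*: wedge f g \+ v \*: wedge h g)%F.
Proof.
apply: functional_extensionality => s.
rewrite /wedge /fadd /fscale !mulr_sumr -big_split /=; apply: eq_bigr => S _; ring.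
Qed.

Lemma fsub_lin2 (u : R) f g : (u \*: f \- g = u \*: f \+ (-1) \*: g)%F.
Proof. by apply: functional_extensionality => s; rewrite /fadd /fsub /fscale mulN1r. Qed.

Lemma fscale_lin2 (u : R) f : (u \*: f = u \*: f \+ 0 \*: f)%F.
Proof. by apply: functional_extensionality => s; rewrite /fadd /fscale mul0r addr0. Qed.

Lemma wedge_eps f a g : wedge f (eps a g) = eps a (wedge (alt f) g).
Proof.
apply: functional_extensionality => s; elim: s f g => [|x s IH] f g.
  by rewrite wedge_nil mulr0.
rewrite wedge_cons IH /=.
have -> : cont x (wedge (alt f) g) =
     ((-1) \*: wedge (alt (cont x f)) g \+ 1 \*: wedge f (cont x g))%F.
  apply: functional_extensionality => t.
  rewrite /cont wedge_cons -/(cont x g) alt_cont altK fscale_lin2 wedge_lin2l.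
  by rewrite /fadd /fscale; ring.
rewrite cont_eps fsub_lin2 wedge_lin2r eps_add !eps_scale /fadd /fscale IH altK; ring.
Qed.

Lemma eb0_cons x s : eb R [::] (x :: s) = 0.
Proof. by []. Qed.

Lemma eb_nil_nil : eb R [::] [::] = 1.
Proof. by rewrite /eb /= det_mx00. Qed.

Lemma wedge_eb0 f : wedge f (eb R [::]) = f.
Proof.
apply: functional_extensionality => s; elim: s f => [|x s IH] f.
  by rewrite wedge_nil eb_nil_nil mulr1.
rewrite wedge_cons IH {1}/wedge big1 ?addr0 // => S _; exact: mulr0.
Qed.

(** Laplace expansion of the defining determinant along its first column, which is the column of
    [a]. *)
Lemma eb_cons a J : eb R (a :: J) = eps a (eb R J).
Proof.
apply: functional_extensionality => s.
(* Written as a sum over all [b] with a Kronecker factor, the left factor becomes an alternating sum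
   over positions whose coefficients are the entries of that column. *)
have -> : eps a (eb R J) s = \sum_b eps b (fun t => (b == a)%:R * eb R J t) s.
  rewrite (bigD1 a) //= eqxx big1 ?addr0.
    by congr eps; apply: functional_extensionality => t; rewrite mul1r.
  by move=> b /negPf->; apply: eps_eq0 => t; rewrite mul0r.
rewrite sum_eps_nth.
case: (eqVneq (size s) (size J).+1) => ss; last first.
  rewrite /eb /= (negPf ss) big1 // => j _.
  case: (size (rm1 s j) =P size J) => sz; last by rewrite !mulr0.
  by case/eqP: ss; rewrite -sz size_rm1 // prednK // (leq_ltn_trans _ (ltn_ord j)).
rewrite [LHS]/eb ss eqxx (expand_det_col _ ord0).
apply: eq_bigr => j _.
rewrite mxE /cofactor addn0 mulrCA; congr (_ * (_ * _)).
have sj : (j < size s)%N by rewrite ss.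
have srm : size (rm1 s j) = size J by rewrite size_rm1 // ss.
rewrite /eb srm eqxx; congr (\det _); apply/matrixP => b c; rewrite !mxE /=.
congr ((_ == _)%:R); rewrite /rm1 nth_cat size_takel; last exact: ltnW.
rewrite /bump; case: ltnP => jb; first by rewrite add0n nth_take.
by rewrite add1n nth_drop addSn subnKC.
Qed.

End Operators.

(** * Contractions and Hodge stars of basis forms *)

Section Basis.
Variable R : comNzRingType.
Implicit Types (f g : form R) (m : 'I_7 -> 'I_7 -> R) (s I K : seq 'I_7).

Lemma antisym_eb I : antisym (eb R I).
Proof.
elim: I => [|a I IH]; last by rewrite eb_cons; apply: antisym_eps.
by move=> p x y s; rewrite /eb /= !size_cat /= addnS oppr0.
Qed.

(** Only one factor can pair with e_x since [K] has no repetition, and [index x K] counts the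
    factors passed to reach it. *)
Lemma eb_contract K x s : uniq K ->
  eb R K (x :: s) = if x \in K then (-1) ^+ index x K * eb R (rem x K) s else 0.
Proof.
elim: K s => [|a K IH] s //= /andP[aK uK].
have ctr : cont x (eb R K) =
   ((if x \in K then (-1) ^+ index x K else 0) \*: eb R (rem x K))%F.
  apply: functional_extensionality => t; rewrite /cont IH // /fscale.
  by case: ifP => //; rewrite mul0r.
rewrite eb_cons /= ctr eps_scale -eb_cons /fscale inE (eq_sym x a).
case: eqP => [<-|_] /=; first by rewrite (negPf aK) mul0r subr0.
by case: ifP => _; rewrite ?exprS; ring.
Qed.

Lemma eb_supp K s : uniq K -> ~~ all (mem K) s -> eb R K s = 0.
Proof.
elim: s K => //= x s IH K uK; rewrite eb_contract //.
case: ifP => //= _ ns; rewrite IH ?mulr0 ?rem_uniq //.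
by apply: contra ns; apply: sub_all => y; apply: mem_rem.
Qed.

Lemma eb_diag K : uniq K -> eb R K K = 1.
Proof.
elim: K => [_|a K IH /= /andP[aK uK]]; first exact: eb_nil_nil.
by rewrite eb_contract /= ?aK // inE eqxx /= mul1r IH.
Qed.

Definition ltord (i j : 'I_7) := (i < j)%N.

Lemma enum_sorted I : sorted ltord I -> enum [set x in I] = I.
Proof.
move=> sI; apply: (@irr_sorted_eq _ ltord) => //.
- by move=> i j k; apply: ltn_trans.
- by move=> i; apply: ltnn.
- have -> : enum [set x in I] = [seq i <- enum 'I_7 | i \in [set x in I]].
    by rewrite [enum 'I_7]enumT.
  apply: sorted_filter; first by move=> i j k; apply: ltn_trans.
  have := iota_ltn_sorted 0 7; rewrite -val_enum_ord sorted_map.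
  exact.
- by move=> i; rewrite mem_enum inE.
Qed.

Lemma sorted_ltord_uniq I : sorted ltord I -> uniq I.
Proof. by move=> sI; rewrite -(enum_sorted sI) enum_uniq. Qed.

(** Enumerations of sets are increasing, and e^I vanishes on each of them other than [I]: either an
    entry lies outside [I], or the length differs. *)
Lemma sum_eb (P : pred {set 'I_7}) (F : seq 'I_7 -> R) I : sorted ltord I ->
  \sum_(S | P S) eb R I (enum S) * F (enum S) = if P [set x in I] then F I else 0.
Proof.
move=> sI; have uI := sorted_ltord_uniq sI.
rewrite big_mkcond (bigD1 [set x in I]) //= big1 ?addr0.
  by rewrite enum_sorted // eb_diag // mul1r.
move=> S nS; case: ifP => // _; suff -> : eb R I (enum S) = 0 by rewrite mul0r.
case: (boolP (all (mem I) (enum S))) => [aS|]; last exact: eb_supp.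
rewrite /eb; case: eqP => // sz; case/eqP: nS; apply/eqP.
rewrite eqEcard !cardE sz enum_sorted // leqnn andbT.
by apply/subsetP => x xS; rewrite inE; apply: (allP aS); rewrite mem_enum.
Qed.

(** No degree condition survives: when the lengths do not add up to 7, [vol] vanishes as well. *)
Lemma hodge_eb I s : sorted ltord I -> hodge (eb R I) s = vol R (I ++ s).
Proof.
move=> sI; rewrite /hodge (sum_eb _ (fun t => vol R (t ++ s)) sI).
rewrite cardE enum_sorted //; case: ifP => // sz.
by rewrite /vol /eb size_cat size_enum_ord sz.
Qed.

Lemma hodge_g1_eb I s : sorted ltord I -> all in_g1 I ->
  hodge_g1 (eb R I) s = vol_g1 R (I ++ s).
Proof.
move=> sI aI; rewrite /hodge_g1 (sum_eb _ (fun t => vol_g1 R (t ++ s)) sI).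
rewrite cardE enum_sorted //.
have -> : [set x in I] \subset g1set.
  by apply/subsetP => x; rewrite !inE; apply: (allP aI).
by rewrite andTb; case: ifP => // sz; rewrite /vol_g1 /ee /eb size_cat sz.
Qed.

Lemma hodge_add f g : hodge (f \+ g)%F = (hodge f \+ hodge g)%F.
Proof.
apply: functional_extensionality => s; rewrite /hodge /fadd -big_split /=.
by apply: eq_bigr => S _; ring.
Qed.

Lemma hodge_sub f g : hodge (f \- g)%F = (hodge f \- hodge g)%F.
Proof.
apply: functional_extensionality => s; rewrite /hodge /fsub -sumrB.
by apply: eq_bigr => S _; ring.
Qed.

Lemma hodge_scale (u : R) f : hodge (u \*: f)%F = (u \*: hodge f)%F.
Proof.
apply: functional_extensionality => s; rewrite /hodge /fscale mulr_sumr.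
by apply: eq_bigr => S _; ring.
Qed.

Lemma hodge_g1_add f g : hodge_g1 (f \+ g)%F = (hodge_g1 f \+ hodge_g1 g)%F.
Proof.
apply: functional_extensionality => s; rewrite /hodge_g1 /fadd -big_split /=.
by apply: eq_bigr => S _; ring.
Qed.

Lemma hodge_g1_scale (u : R) f : hodge_g1 (u \*: f)%F = (u \*: hodge_g1 f)%F.
Proof.
apply: functional_extensionality => s; rewrite /hodge_g1 /fscale mulr_sumr.
by apply: eq_bigr => S _; ring.
Qed.

Lemma act_nth m f s :
  act m f s = \sum_(i < size s) \sum_k m k (nth ord0 s i) * f (set_nth ord0 s i k).
Proof.
elim: s f => [|x s IH] f; first by rewrite big_ord0.
by rewrite big_ord_recl /= IH.
Qed.

Lemma theta_act (M : 'M[R]_4) f : theta M f = (-1 \*: act (extg1 M) f)%F.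
Proof.
by apply: functional_extensionality => s; rewrite /fscale mulN1r act_nth.
Qed.

End Basis.

(** * The concrete basis and the differential of the given Lie algebra *)

Local Notation e1 := (@Ordinal 7 0 isT).
Local Notation e2 := (@Ordinal 7 1 isT).
Local Notation e3 := (@Ordinal 7 2 isT).
Local Notation e4 := (@Ordinal 7 3 isT).
Local Notation e5 := (@Ordinal 7 4 isT).
Local Notation e6 := (@Ordinal 7 5 isT).
Local Notation e7 := (@Ordinal 7 6 isT).

Lemma inord7 : (inord 0 = e1) * (inord 1 = e2) * (inord 2 = e3) * (inord 3 = e4) *
  (inord 4 = e5) * (inord 5 = e6) * (inord 6 = e7).
Proof. by do !split; apply: val_inj; rewrite /= inordK. Qed.

Lemma sum7 (V : zmodType) (F : 'I_7 -> V) :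
  \sum_k F k = F e1 + F e2 + F e3 + F e4 + F e5 + F e6 + F e7.
Proof.
rewrite !big_ord_recl big_ord0 addr0 !addrA.
by do ![congr (_ + _)]; congr F; apply: val_inj.
Qed.

Lemma enum_ord7 : enum 'I_7 = [:: e1; e2; e3; e4; e5; e6; e7].
Proof. by apply: (inj_map val_inj); rewrite val_enum_ord. Qed.

Section Explicit.
Variable R : comNzRingType.
Implicit Types (f g : form R) (a b c : 'I_7) (M : 'M[R]_4).

(** Shown by its own recursion, since anticommutation alone only gives twice the claim in a general
    ring. *)
Lemma eps_sq a (f : form R) : eps a (eps a f) = (fun=> 0).
Proof.
apply: functional_extensionality => s; elim: s f => [|x s IH] f //=.
rewrite cont_eps eps_sub eps_scale /fsub /fscale IH; ring.
Qed.

Lemma eps_sq1 a b (f : form R) : eps a (eps b (eps a f)) = (fun=> 0).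
Proof.
rewrite (eps_anticomm b) eps_scale eps_sq.
by apply: functional_extensionality => s; rewrite /fscale mulr0.
Qed.

(** Two transpositions, hence no sign; used to bring index lists into increasing order. *)
Lemma eps_cycle a b c (f : form R) : eps a (eps b (eps c f)) = eps b (eps c (eps a f)).
Proof.
rewrite eps_anticomm (eps_anticomm a) eps_scale.
by apply: functional_extensionality => s; rewrite /fscale; ring.
Qed.

Lemma eps_sq2 a b c f : eps a (eps b (eps c (eps a f))) = (fun=> 0).
Proof. by rewrite -(eps_cycle a b c) eps_sq. Qed.

Lemma act_eq0 m (f : form R) : (forall t, f t = 0) -> act m f = (fun=> 0).
Proof.
move=> f0; apply: functional_extensionality => s; elim: s f f0 => //= x s IH f f0.
rewrite IH ?addr0 ?big1 // => k; first by rewrite f0 mulr0.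
exact: f0.
Qed.

Lemma act_eb0 m : act m (eb R [::]) = (fun=> 0).
Proof.
apply: functional_extensionality => -[|x s] //=.
by rewrite (act_eq0 m (f := cont x _)) // addr0 big1 // => k _; rewrite eb0_cons mulr0.
Qed.

Lemma eps0 a : eps a (fun=> 0 : R) = (fun=> 0).
Proof. by apply: functional_extensionality => s; apply: eps_eq0. Qed.

Lemma act_extg1_eps_in (M : 'M[R]_4) a f : in_g1 a ->
  let m k := M (g1i a) (g1i k) in
  act (extg1 M) (eps a f) =
  (m e3 \*: eps e3 f \+ m e4 \*: eps e4 f \+ m e5 \*: eps e5 f \+ m e6 \*: eps e6 f
   \+ eps a (act (extg1 M) f))%F.
Proof.
move=> ga; rewrite act_eps; apply: functional_extensionality => s.
by rewrite sum7 /extg1 ga /= /fadd /fscale; ring.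
Qed.

Lemma act_extg1_eps_out (M : 'M[R]_4) a f : ~~ in_g1 a ->
  act (extg1 M) (eps a f) = eps a (act (extg1 M) f).
Proof.
move=> /negPf ga; rewrite act_eps; apply: functional_extensionality => s.
by rewrite /extg1 ga big1 ?add0r // => k _; rewrite mul0r.
Qed.

Definition ext12 (A1 : 'M[R]_2) (k j : 'I_7) : R :=
  if (j < 2)%N && (k < 2)%N then A1 (i2 k) (i2 j) else 0.

Lemma act_ext12_eps_out (A1 : 'M[R]_2) a f : (2 <= a)%N ->
  act (ext12 A1) (eps a f) = eps a (act (ext12 A1) f).
Proof.
move=> ga; rewrite act_eps; apply: functional_extensionality => s.
by rewrite /ext12 ltnNge ga big1 ?add0r // => k _; rewrite andbF mul0r.
Qed.

Lemma act_ext12_eps_in (A1 : 'M[R]_2) a f : (a < 2)%N ->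
  act (ext12 A1) (eps a f) =
  (A1 (i2 a) (i2 e1) \*: eps e1 f \+ A1 (i2 a) (i2 e2) \*: eps e2 f
   \+ eps a (act (ext12 A1) f))%F.
Proof.
move=> ga; rewrite act_eps; apply: functional_extensionality => s.
by rewrite sum7 /ext12 ga /= /fadd /fscale; ring.
Qed.

(** Only e_1, e_2 and e_7 act. The operator of e_7 is the sum of two blocks with disjoint supports,
    and [theta] absorbs the global minus sign. *)
Lemma dform_sc (A1 : 'M[R]_2) (A B C : 'M[R]_4) f : antisym f ->
  dform (sc A1 A B C) f =
  (eps e7 (theta A f) \- eps e7 (act (ext12 A1) f)
   \+ eps e1 (theta B f) \+ eps e2 (theta C f))%F.
Proof.
move=> sf; apply: functional_extensionality => s.
rewrite (dform_sum_eps (adp A1 A B C) s sf) sum7 !theta_act !eps_scale.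
have -> : (fun k j => adp A1 A B C e7 j k) = (fun k j => ext12 A1 k j + extg1 A k j).
  apply: functional_extensionality => k; apply: functional_extensionality => j.
  rewrite /adp /= /ext12 /extg1 [in_g1 j && _]andbC.
  case: ifP => [/andP[j2 k2]|_]; last by rewrite add0r.
  by have -> : in_g1 k = false by [rewrite /in_g1 leqNgt k2]; rewrite addr0.
have -> : (fun k j => adp A1 A B C e1 j k) = extg1 B.
  by do 2![apply: functional_extensionality => ?]; rewrite /adp /= /extg1 [in_g1 _ && _]andbC.
have -> : (fun k j => adp A1 A B C e2 j k) = extg1 C.
  by do 2![apply: functional_extensionality => ?]; rewrite /adp /= /extg1 [in_g1 _ && _]andbC.
have act00 : act (fun _ _ => 0) f = (fun=> 0).
  apply: functional_extensionality => t; rewrite act_nth big1 // => i _.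
  by rewrite big1 // => k _; rewrite mul0r.
rewrite /adp /= act00 !eps0 actD_mat eps_add /fadd /fsub /fscale; ring.
Qed.

Lemma theta_add (M : 'M[R]_4) f g : theta M (f \+ g)%F = (theta M f \+ theta M g)%F.
Proof.
rewrite !theta_act act_add; apply: functional_extensionality => s.
by rewrite /fscale /fadd; ring.
Qed.

Lemma theta_sub (M : 'M[R]_4) f g : theta M (f \- g)%F = (theta M f \- theta M g)%F.
Proof.
rewrite !theta_act act_sub; apply: functional_extensionality => s.
by rewrite /fscale /fsub; ring.
Qed.

Lemma theta_scale (M : 'M[R]_4) u f : theta M (u \*: f)%F = (u \*: theta M f)%F.
Proof.
rewrite !theta_act act_scale; apply: functional_extensionality => s.
by rewrite /fscale; ring.
Qed.

Lemma theta_eps_out (M : 'M[R]_4) a f : ~~ in_g1 a ->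
  theta M (eps a f) = eps a (theta M f).
Proof. by move=> ga; rewrite !theta_act act_extg1_eps_out // eps_scale. Qed.

Lemma mxtrace_g1 (M : 'M[R]_4) : \tr M =
  M (g1i e3) (g1i e3) + M (g1i e4) (g1i e4) + M (g1i e5) (g1i e5) + M (g1i e6) (g1i e6).
Proof.
rewrite /mxtrace !big_ord_recl big_ord0 addr0 !addrA.
by do ![congr (_ + _)]; congr (M _ _); apply: val_inj; rewrite /= inordK.
Qed.

Lemma mxtrace_12 (M : 'M[R]_2) : \tr M = M (i2 e1) (i2 e1) + M (i2 e2) (i2 e2).
Proof.
rewrite /mxtrace !big_ord_recl big_ord0 addr0.
by congr (_ + _); congr (M _ _); apply: val_inj; rewrite /= inordK.
Qed.

(** Off-diagonal entries of [M] repeat a factor and vanish, so only the trace remains. *)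
Lemma theta_vol_g1 (M : 'M[R]_4) :
  theta M (eb R [:: e3; e4; e5; e6]) = (- \tr M \*: eb R [:: e3; e4; e5; e6])%F.
Proof.
rewrite theta_act mxtrace_g1 !eb_cons.
do 4 rewrite ?act_extg1_eps_in // ?eps_add ?eps_scale.
rewrite act_eb0 !(eps_sq, eps_sq1, eps_sq2, eps0).
by apply: functional_extensionality => s; rewrite /fadd /fscale /=; ring.
Qed.

(** * Two-forms on g1 in coordinates *)

Definition form2 (u34 u35 u36 u45 u46 u56 : R) : form R :=
  (u34 \*: eb R [:: e3; e4] \+ u35 \*: eb R [:: e3; e5] \+ u36 \*: eb R [:: e3; e6]
   \+ u45 \*: eb R [:: e4; e5] \+ u46 \*: eb R [:: e4; e6] \+ u56 \*: eb R [:: e5; e6])%F.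

(** For the skew matrix U of coefficients this is the rule U -> -(M^T U + U M). *)
Lemma theta_form2 (M : 'M[R]_4) u34 u35 u36 u45 u46 u56 :
  let m i j := M (g1i i) (g1i j) in
  theta M (form2 u34 u35 u36 u45 u46 u56) = form2
   (- ((m e3 e3 + m e4 e4) * u34 - m e5 e3 * u45 - m e6 e3 * u46 + m e5 e4 * u35 + m e6 e4 * u36))
   (- ((m e3 e3 + m e5 e5) * u35 + m e4 e3 * u45 - m e6 e3 * u56 + m e4 e5 * u34 + m e6 e5 * u36))
   (- ((m e3 e3 + m e6 e6) * u36 + m e4 e3 * u46 + m e5 e3 * u56 + m e4 e6 * u34 + m e5 e6 * u35))
   (- ((m e4 e4 + m e5 e5) * u45 + m e3 e4 * u35 - m e6 e4 * u56 - m e3 e5 * u34 + m e6 e5 * u46))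
   (- ((m e4 e4 + m e6 e6) * u46 + m e3 e4 * u36 + m e5 e4 * u56 - m e3 e6 * u34 + m e5 e6 * u45))
   (- ((m e5 e5 + m e6 e6) * u56 + m e3 e5 * u36 + m e4 e5 * u46 - m e3 e6 * u35 - m e4 e6 * u45)).
Proof.
rewrite /= /form2 !theta_add !theta_scale !theta_act !eb_cons.
rewrite !act_extg1_eps_in // act_eb0 !eps_add !eps_scale !(eps_sq, eps0).
rewrite (eps_anticomm e4 e3) (eps_anticomm e5 e3).
rewrite (eps_anticomm e5 e4) (eps_anticomm e6 e4) (eps_anticomm e6 e5).
apply: functional_extensionality => s; rewrite /fadd /fscale /=.
ring.
Qed.

Lemma hodge_g1_form2 u34 u35 u36 u45 u46 u56 :
  hodge_g1 (form2 u34 u35 u36 u45 u46 u56) = form2 u56 (- u46) u45 u36 (- u35) u34.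
Proof.
rewrite /form2 !hodge_g1_add !hodge_g1_scale.
apply: functional_extensionality => s; rewrite /fadd /fscale !hodge_g1_eb //.
rewrite /vol_g1 /ee /= !inord7 !eb_contract //=; ring.
Qed.

(** The volume form is e^127 ∧ e^3456, as e^7 passes four factors without a sign; so the star of
    e^127 ∧ f is the star of [f] inside g1. *)
Lemma hodge_wedge127_form2 u34 u35 u36 u45 u46 u56 :
  let f := form2 u34 u35 u36 u45 u46 u56 in
  hodge (eps e1 (eps e2 (eps e7 f))) = hodge_g1 f.
Proof.
rewrite /= hodge_g1_form2 /form2 !eps_add !eps_scale !eb_cons !(eps_cycle e7) -!eb_cons.
rewrite !hodge_add !hodge_scale.
apply: functional_extensionality => s; rewrite /fadd /fscale !hodge_eb //.
rewrite /vol enum_ord7 /= !eb_contract //=; ring.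
Qed.

Lemma form2_add u34 u35 u36 u45 u46 u56 v34 v35 v36 v45 v46 v56 :
  (form2 u34 u35 u36 u45 u46 u56 \+ form2 v34 v35 v36 v45 v46 v56)%F =
  form2 (u34 + v34) (u35 + v35) (u36 + v36) (u45 + v45) (u46 + v46) (u56 + v56).
Proof.
by apply: functional_extensionality => s; rewrite /form2 /fadd /fscale; ring.
Qed.

Lemma form2_sub u34 u35 u36 u45 u46 u56 v34 v35 v36 v45 v46 v56 :
  (form2 u34 u35 u36 u45 u46 u56 \- form2 v34 v35 v36 v45 v46 v56)%F =
  form2 (u34 - v34) (u35 - v35) (u36 - v36) (u45 - v45) (u46 - v46) (u56 - v56).
Proof.
by apply: functional_extensionality => s; rewrite /form2 /fadd /fsub /fscale; ring.
Qed.

Lemma form2_scale (c : R) u34 u35 u36 u45 u46 u56 :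
  (c \*: form2 u34 u35 u36 u45 u46 u56)%F =
  form2 (c * u34) (c * u35) (c * u36) (c * u45) (c * u46) (c * u56).
Proof.
by apply: functional_extensionality => s; rewrite /form2 /fadd /fscale; ring.
Qed.

Lemma alt_eb I : ~~ odd (size I) -> alt (eb R I) = eb R I.
Proof.
move=> oI; apply: functional_extensionality => s; rewrite /alt /eb.
by case: eqP => [->|_]; rewrite ?mulr0 // -signr_odd (negPf oI) mul1r.
Qed.

Lemma alt_form2 u34 u35 u36 u45 u46 u56 :
  alt (form2 u34 u35 u36 u45 u46 u56) = form2 u34 u35 u36 u45 u46 u56.
Proof.
apply: functional_extensionality => s; rewrite /form2 /fadd /fscale.
have ebE I : ~~ odd (size I) -> (-1) ^+ size s * eb R I s = eb R I s.
  by move=> oI; rewrite -{2}alt_eb.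
by rewrite /alt !mulrDr !(mulrCA ((-1) ^+ _)) !ebE.
Qed.

Lemma antisym_form2 u34 u35 u36 u45 u46 u56 : antisym (form2 u34 u35 u36 u45 u46 u56).
Proof. by rewrite /form2; do ![apply: antisym_add]; apply: antisym_scale; apply: antisym_eb. Qed.

Lemma act_ext12_form2 (A1 : 'M[R]_2) u34 u35 u36 u45 u46 u56 :
  act (ext12 A1) (form2 u34 u35 u36 u45 u46 u56) = (fun=> 0).
Proof.
rewrite /form2 !act_add !act_scale !eb_cons !act_ext12_eps_out // act_eb0 !eps0.
by apply: functional_extensionality => s; rewrite /fadd /fscale /=; ring.
Qed.

Lemma wedge_eb_even f I : alt f = f -> wedge f (eb R I) = foldr (@eps R) f I.
Proof.
move=> ef; elim: I => [|a I IH]; first exact: wedge_eb0.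
by rewrite eb_cons wedge_eps ef IH.
Qed.

(** * The forms omega_i, the star of phi and its differential *)

Lemma omega7E : omega7 = form2 1 0 0 0 0 1.
Proof.
apply: functional_extensionality => s.
by rewrite /omega7 /form2 /ee /= !inord7 /fadd /fscale; ring.
Qed.

Lemma omega1E : omega1 = form2 0 1 0 0 (-1) 0.
Proof.
apply: functional_extensionality => s.
by rewrite /omega1 /form2 /ee /= !inord7 /fadd /fsub /fscale; ring.
Qed.

Lemma omega2E : omega2 = form2 0 0 (-1) (-1) 0 0.
Proof.
apply: functional_extensionality => s.
by rewrite /omega2 /form2 /ee /= !inord7 /fadd /fsub /fscale; ring.
Qed.

(** Grouping phi as e^127 + omega_7 ∧ e^7 + e^1 ∧ omega_1 + e^2 ∧ omega_2, the four groups have the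
    four displayed terms as stars, in this order. *)
Lemma hodge_phi0 : hodge (phi0 : form R) =
  (eb R [:: e3; e4; e5; e6] \+ eps e1 (eps e2 omega7)
   \+ eps e2 (eps e7 omega1) \- eps e1 (eps e7 omega2))%F.
Proof.
rewrite /phi0 /ee /= !inord7 !(hodge_add, hodge_sub) omega7E omega1E omega2E /form2.
rewrite !eps_add !eps_scale !eb_cons !(eps_cycle e7) -!eb_cons.
apply: functional_extensionality => s; rewrite /fadd /fsub /fscale !hodge_eb //.
rewrite /vol enum_ord7 /= !eb_contract //=; ring.
Qed.

Lemma antisym_hodge_phi0 : antisym (hodge (phi0 : form R)).
Proof.
rewrite hodge_phi0 omega7E omega1E omega2E.
apply: antisym_sub; last by do 2!apply: antisym_eps; apply: antisym_form2.
apply: antisym_add; last by do 2!apply: antisym_eps; apply: antisym_form2.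
apply: antisym_add; last by do 2!apply: antisym_eps; apply: antisym_form2.
exact: antisym_eb.
Qed.

Lemma act_ext12_eps12 (A1 : 'M[R]_2) f : act (ext12 A1) f = (fun=> 0) ->
  act (ext12 A1) (eps e1 (eps e2 f)) = (\tr A1 \*: eps e1 (eps e2 f))%F.
Proof.
move=> f0; rewrite act_ext12_eps_in // (act_ext12_eps_in _ (a := e2)) // f0.
rewrite !eps_add !eps_scale !eps0 !eps_sq mxtrace_12.
apply: functional_extensionality => s; rewrite /fadd /fscale /=.
ring.
Qed.

Lemma dform_hodge_phi0 (A1 : 'M[R]_2) (A B C : 'M[R]_4) :
  \tr B = 0 -> \tr C = 0 ->
  dform (sc A1 A B C) (hodge phi0) =
  ((- \tr A) \*: eps e7 (eb R [:: e3; e4; e5; e6])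
   \+ eps e1 (eps e2 (eps e7 (theta A omega7 \- \tr A1 \*: omega7
                              \+ theta B omega1 \+ theta C omega2))))%F.
Proof.
move=> trB trC; rewrite dform_sc; last exact: antisym_hodge_phi0.
have := act_ext12_form2 A1 1 0 0 0 0 1; have := act_ext12_form2 A1 0 1 0 0 (-1) 0.
have := act_ext12_form2 A1 0 0 (-1) (-1) 0 0; rewrite hodge_phi0 -omega7E -omega1E -omega2E.
(* From here the three forms matter only through being annihilated by the [A1] block. *)
move: omega7 omega1 omega2 => w7 w1 w2 w2_0 w1_0 w7_0.
rewrite !(theta_add, theta_sub, theta_vol_g1) !theta_eps_out // trB trC.
rewrite !(act_add, act_sub) act_ext12_eps12 //.
rewrite (_ : act (ext12 A1) (eb R [:: e3; e4; e5; e6]) = (fun=> 0)); last first.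
  by rewrite !eb_cons !act_ext12_eps_out // act_eb0 !eps0.
rewrite (act_ext12_eps_in _ _ (a := e2)) // (act_ext12_eps_in _ _ (a := e1)) //.
rewrite !act_ext12_eps_out // w1_0 w2_0.
(* Repeated factors vanish, so e^7, e^1 and e^2 each meet just one of the terms with omega_7,
   omega_1, omega_2. *)
rewrite !(eps_add, eps_sub, eps_scale, eps_sq, eps_sq1, eps0).
rewrite !(eps_cycle e7 e1 e2) (eps_anticomm e2 e1).
apply: functional_extensionality => s; rewrite /fadd /fsub /fscale /=.
ring.
Qed.

Lemma theta_eb12 M : theta M (eb R [:: e1; e2]) = (fun=> 0).
Proof.
rewrite !eb_cons !theta_eps_out // theta_act act_eb0 eps_scale eps0 eps_scale eps0.
by apply: functional_extensionality => s; rewrite /fscale mulr0.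
Qed.

End Explicit.

(** * Self-duality and the four formulas *)

Theorem theorem2p4 (R : realFieldType) (A1 : 'M[R]_2) (A B C : 'M[R]_4) :
  \tr B = 0 -> \tr C = 0 ->
  A *m B - B *m A = A1 0 0 *: B + A1 1 0 *: C ->
  A *m C - C *m A = A1 0 1 *: B + A1 1 1 *: C ->
  B *m C - C *m B = 0 ->
  let d := dform (sc A1 A B C) in
  let sphi := hodge phi0 in
  let gam := (theta A omega7 \- \tr A1 \*: omega7 \+ theta B omega1
              \+ theta C omega2)%F in
  let beta := ((\tr A1 + \tr A) \*: omega7 \+ theta A^T omega7
               \+ theta B^T omega1 \+ theta C^T omega2)%F in
  [/\ sphi = (ee R [:: 3; 4; 5; 6]%N \+ omega7 \wedge ee R [:: 1; 2]%N
              \+ omega1 \wedge ee R [:: 2; 7]%N \- omega2 \wedge ee R [:: 1; 7]%N)%F,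
      d sphi = ((- \tr A) \*: ee R [:: 3; 4; 5; 6; 7]%N \+ gam \wedge ee R [:: 1; 2; 7]%N)%F,
      hodge (d sphi) = ((- \tr A) \*: ee R [:: 1; 2]%N \+ hodge_g1 gam)%F &
      d (hodge (d sphi)) = ((\tr A1 * \tr A) \*: ee R [:: 1; 2; 7]%N
                            \- theta A beta \wedge ee R [:: 7]%N
                            \- theta B beta \wedge ee R [:: 1]%N
                            \- theta C beta \wedge ee R [:: 2]%N)%F].
Proof.
move=> trB trC _ _ _ d sphi gam beta.
have [g34 [g35 [g36 [g45 [g46 [g56 gamE]]]]]] : exists u34 u35 u36 u45 u46 u56,
    gam = form2 u34 u35 u36 u45 u46 u56.
  rewrite /gam omega7E omega1E omega2E !theta_form2 form2_scale form2_sub !form2_add.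
  by do 6!eexists.
have [b34 [b35 [b36 [b45 [b46 [b56 betaE]]]]]] : exists u34 u35 u36 u45 u46 u56,
    beta = form2 u34 u35 u36 u45 u46 u56.
  rewrite /beta omega7E omega1E omega2E !theta_form2 form2_scale !form2_add.
  by do 6!eexists.
(* For self-dual omega, the star of theta(M) omega is -(theta(M^t) omega + tr(M) omega); the traces
   of [B] and [C] vanish. *)
have hgam : hodge_g1 gam = (-1 \*: beta)%F.
  rewrite /gam /beta omega7E omega1E omega2E !theta_form2 !form2_scale form2_sub !form2_add.
  rewrite hodge_g1_form2 form2_scale !mxtrace_g1 !mxE.
  (* Each trace condition is solved for the last diagonal entry, which [ring] then substitutes. *)
  move: trB trC; rewrite !mxtrace_g1 => /eqP; rewrite addrC addr_eq0 => /eqP trB /eqP.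
  by rewrite addrC addr_eq0 => /eqP trC; congr form2; ring: trB trC.
have dsphi : d sphi = ((- \tr A) \*: eps e7 (eb R [:: e3; e4; e5; e6])
                       \+ eps e1 (eps e2 (eps e7 gam)))%F by exact: dform_hodge_phi0.
clearbody beta gam.
have hdsphi : hodge (d sphi) = ((- \tr A) \*: eb R [:: e1; e2] \+ hodge_g1 gam)%F.
  rewrite dsphi hodge_add hodge_scale {1}gamE hodge_wedge127_form2 -gamE; congr fadd.
  (* Moving e^7 past two pairs gives the increasing e^34567, whose star is e^12. *)
  rewrite !eb_cons (eps_cycle e7 e3 e4) (eps_cycle e7 e5 e6) -!eb_cons.
  apply: functional_extensionality => s; rewrite /fscale hodge_eb // /vol enum_ord7.
  by rewrite !eb_contract //=; ring.
split.
- rewrite /sphi hodge_phi0 /ee /= !inord7 !wedge_eb_even //=.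
  + by rewrite omega2E alt_form2.
  + by rewrite omega1E alt_form2.
  + by rewrite omega7E alt_form2.
- rewrite dsphi /ee /= !inord7 wedge_eb_even //= ?gamE ?alt_form2 //.
  rewrite !eb_cons (eps_cycle e7 e3 e4) (eps_cycle e7 e5 e6). done.
- by rewrite hdsphi /ee /= !inord7.
- rewrite hdsphi hgam /d dform_sc; last first.
    apply: antisym_add; first exact/antisym_scale/antisym_eb.
    by rewrite betaE; apply/antisym_scale/antisym_form2.
  have alt_theta M : alt (theta M beta) = theta M beta.
    by rewrite betaE theta_form2 alt_form2.
  have beta12 : act (ext12 A1) beta = (fun=> 0) by rewrite betaE act_ext12_form2.
  rewrite /ee /= !inord7 !wedge_eb_even //=.
  (* On e^12 only the [A1] block acts, giving the term with both traces; on beta it vanishes and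
     only the three theta terms remain. *)
  rewrite !(theta_add, theta_scale, theta_eb12, act_add, act_scale).
  rewrite !eb_cons act_ext12_eps12 ?act_eb0 // beta12.
  rewrite !(eps_add, eps_scale, eps0) (eps_cycle e7).
  by apply: functional_extensionality => s; rewrite /fadd /fsub /fscale /=; ring.
Qed.
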